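(* Let $C=F_x\rtimes F_w$ be the subgroup of $PL_2^+(\mathbb{R})$ generated by $x_0,x_1,w_0,w_1$, and let $|g|_C$ denote word length with respect to these generators. There exists a constant $K>0$ such that for every $g\in C$, $$a(g)+\sqrt{b(g)}+c(g)\le K\,|g|_C .$$
   Context: $PL_2^+(\mathbb{R})$ is the group of orientation-preserving piecewise-linear homeomorphisms of $\mathbb{R}$ whose breakpoints form a discrete (possibly infinite) set of points of $\mathbb{Z}[\tfrac12]$ and whose slopes are powers of $2$. Products $gh$ are compositions with maps acting on the right (first $g$, then $h$). Thompson's group $F$ is the group of orientation-preserving piecewise-linear homeomorphisms of $[0,1]$ with finitely many breakpoints, all in $\mathbb{Z}[\tfrac12]$, and slopes powers of $2$. It is generated by $f_0,f_1$: $f_0$ maps $[0,\frac14],[\frac14,\frac12],[\frac12,1]$ affinely onto $[0,\frac12],[\frac12,\frac34],[\frac34,1]$ respectively, and $f_1$ is the identity on $[0,\frac12]$ and is the copy of $f_0$ rescaled to $[\frac12,1]$ on that interval. Tree diagrams. A caret of a finite rooted binary tree is an internal node with its two downward edges. A finite rooted binary tree encodes a subdivision of $[0,1]$: the root is $[0,1]$ and each caret halves its interval. A pair of such trees with the same number of leaves represents the element of $F$ mapping the leaf intervals of the first tree affinely, in order, onto those of the second. Every element of $F$ has a unique reduced (minimal) such diagram; both trees have the same number of carets, called the number of carets of the diagram (it is $0$ for the identity). A left (respectively right) caret is a non-root caret whose interval contains $0$ (respectively $1$). Real-line version. $F$ is identified, by conjugating by the homeomorphism $(0,1)\to\mathbb{R}$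 sending $\frac12\mapsto 0$, $1-2^{-k-1}\mapsto k$ and $2^{-k-1}\mapsto -k$ for integers $k\ge0$, affine in between, with the subgroup $F_x\subset PL_2^+(\mathbb{R})$ of all $f$ for which there are $M>0$ and integers $k,l$ with $f(u)=u+k$ for $u>M$ and $f(u)=u+l$ for $u<-M$. Under this identification $f_0,f_1$ become $x_0,x_1$: $x_0(u)=u+1$; $x_1(u)=u$ for $u\le0$, $2u$ for $0\le u\le1$, $u+1$ for $u\ge1$. The reduced diagram of an element of $F_x$ means that of the corresponding element of $F$. For $f\in F$ let $\sigma(f)\in PL_2^+(\mathbb{R})$ be the periodic map $\sigma(f)(k+u)=k+f(u)$, $k\in\mathbb{Z}$, $u\in[0,1]$. Set $w_i=\sigma(f_i)$ for $i=0,1$ and $F_w=\langle w_0,w_1\rangle=\sigma(F)\cong F$. Then $F_x$ is normal in $C$, and there is a split short exact sequence $1\to F_x\to C\xrightarrow{\ \pi\ }F\to1$ with $\pi\circ\sigma=\mathrm{id}$. For $g\in C$, the debris of $g$ is $d_g=(\sigma(\pi(g)))^{-1}g\in F_x$. Define: $a(g)$ is the number of carets of the reduced diagram of $\pi(g)\in F$; $b(g)$ is the number of carets of the reduced diagram of $d_g\in F_x$; $c(g)$ is the total number of left and right carets (not counting the roots) in both trees of the reduced diagram of $d_g$. *)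

(* Defs.v *)
From HB Require Import structures.
From mathcomp Require Import all_boot all_order all_algebra.
From mathcomp Require Import all_classical all_reals all_analysis.
Import Order.TTheory GRing.Theory Num.Theory.
Import numFieldNormedType.Exports.

Set Implicit Arguments.
Unset Strict Implicit.
Unset Printing Implicit Defensive.

Local Open Scope classical_set_scope.
Local Open Scope ring_scope.

(* Elements of all the groups below are plain functions R -> R.  Maps act on
   the right, so the product of g and h is the ssrfun composition g \; h. *)

Definition homeo_incr (R : realType) (f : R -> R) : Prop :=
  {homo f : x y / x < y} /\
  exists g : R -> R,
    [/\ cancel f g, cancel g f, continuous f & continuous g].

Definition inverse (R : realType) (f : R -> R) : R -> R := pinv setT f.

Definition dyadic (R : realType) : set R :=
  [set x | exists (m : int) (n : nat), x = m%:~R / 2 ^+ n].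

Definition affine_near (R : realType) (f : R -> R) (x a b : R) : Prop :=
  \forall y \near x, f y = a * y + b.

Definition breakpoint (R : realType) (f : R -> R) : set R :=
  [set x | ~ exists a b, affine_near f x a b].

(* Since [breakpoint f] is closed, discreteness amounts to local finiteness. *)
Definition PL2 (R : realType) : set (R -> R) :=
  [set f | [/\ homeo_incr f,
               breakpoint f `<=` isolated (breakpoint f),
               breakpoint f `<=` @dyadic R &
               forall x a b, affine_near f x a b -> exists n : int, a = 2 ^ n]].

(* A homeomorphism of [0, 1] is encoded by its extension by the identity
   outside [0, 1]; the only breakpoints this may create are 0 and 1. *)
Definition thompsonF (R : realType) : set (R -> R) :=
  [set f | [/\ PL2 f, finite_set (breakpoint f) &
               forall t, ~~ (0 <= t <= 1) -> f t = t]].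

Definition f0 (R : realType) (t : R) : R :=
  if t <= 0 then t
  else if t <= 1 / 4 then 2 * t
  else if t <= 1 / 2 then t + 1 / 4
  else if t <= 1 then t / 2 + 1 / 2
  else t.

(* f0 conjugated by t |-> (1 + t) / 2. *)
Definition f1 (R : realType) (t : R) : R := (1 + f0 (2 * t - 1)) / 2.

Definition Fx (R : realType) : set (R -> R) :=
  [set f | PL2 f /\ exists (M : R) (k l : int),
     [/\ 0 < M, forall u, u > M -> f u = u + k%:~R &
                forall u, u < - M -> f u = u + l%:~R]].

Definition x0 (R : realType) (u : R) : R := u + 1.

Definition x1 (R : realType) (u : R) : R :=
  if u <= 0 then u else if u <= 1 then 2 * u else u + 1.

Definition sigma (R : realType) (f : R -> R) (t : R) : R :=
  (Num.floor t)%:~R + f (t - (Num.floor t)%:~R).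

Definition w0 (R : realType) : R -> R := sigma (@f0 R).
Definition w1 (R : realType) : R -> R := sigma (@f1 R).

Inductive generator := X0 | X1 | W0 | W1.

Definition gen_map (R : realType) (s : generator) : R -> R :=
  match s with
  | X0 => @x0 R
  | X1 => @x1 R
  | W0 => @w0 R
  | W1 => @w1 R
  end.

(* (s, true) stands for the generator s, (s, false) for its inverse. *)
Definition letter := (generator * bool)%type.

Definition letter_map (R : realType) (l : letter) : R -> R :=
  if l.2 then @gen_map R l.1 else inverse (@gen_map R l.1).

Definition word_map (R : realType) (w : seq letter) : R -> R :=
  foldr (fun l g => @letter_map R l \; g) id w.

Definition groupC (R : realType) : set (R -> R) := range (@word_map R).

(* Junk value 0 if g is not in C. *)
Definition word_length (R : realType) (g : R -> R) : nat :=
  xget 0%N [set n | (exists2 w, size w = n & @word_map R w = g) /\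
                    forall w, @word_map R w = g -> (n <= size w)%N].

(* pi_C g is the F-component of g in the semidirect product: the unique f in F
   such that g = sigma f \; d with d in Fx. *)
Definition pi_C (R : realType) (g : R -> R) : R -> R :=
  xget (@id R : R -> R) [set f | thompsonF f /\ Fx (inverse (sigma f) \; g)].

Definition debris (R : realType) (g : R -> R) : R -> R :=
  inverse (sigma (pi_C g)) \; g.

(* The inverse R -> (0, 1) of the identification of (0, 1) with R: for natural
   numbers k it sends k to 1 - 2^(-k-1) and -k to 2^(-k-1), and it is affine
   between consecutive integers. *)
Definition line_to_unit (R : realType) (u : R) : R :=
  let half_line (v : R) : R :=
    let k := Num.truncn v in
    1 - 2 ^- k.+1 + (v - k%:R) * 2 ^- k.+2 in
  if 0 <= u then half_line u else 1 - half_line (- u).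

Definition unit_to_line (R : realType) : R -> R := inverse (@line_to_unit R).

(* The element of F corresponding to an element of Fx. *)
Definition to_F (R : realType) (d : R -> R) (t : R) : R :=
  if 0 < t < 1 then line_to_unit (d (unit_to_line t)) else t.

Inductive tree := Leaf | Node of tree & tree.

HB.instance Definition _ := gen_eqMixin tree.
HB.instance Definition _ := gen_choiceMixin tree.

(* Intervals are given by their endpoints; [a, b] is the interval of the root
   of the tree. *)
Fixpoint leaves (R : realType) (T : tree) (a b : R) : seq (R * R) :=
  match T with
  | Leaf => [:: (a, b)]
  | Node l r => leaves l a ((a + b) / 2) ++ leaves r ((a + b) / 2) b
  end.

(* The intervals of the carets of the tree, the root (if a caret) first. *)
Fixpoint carets (R : realType) (T : tree) (a b : R) : seq (R * R) :=
  match T with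
  | Leaf => [::]
  | Node l r => (a, b) :: carets l a ((a + b) / 2) ++ carets r ((a + b) / 2) b
  end.

Definition ncarets (R : realType) (T : tree) : nat :=
  size (carets T (0 : R) 1).

(* Left and right carets; a non-root caret cannot be both. *)
Definition nside_carets (R : realType) (T : tree) : nat :=
  count (fun I : R * R => (I.1 <= 0 <= I.2) || (I.1 <= 1 <= I.2))
        (behead (carets T (0 : R) 1)).

Definition represents (R : realType) (D : tree * tree) (f : R -> R) : Prop :=
  size (leaves D.1 (0 : R) 1) = size (leaves D.2 (0 : R) 1) /\
  forall I J : R * R,
    (I, J) \in zip (leaves D.1 0 1) (leaves D.2 0 1) ->
    forall t, I.1 <= t <= I.2 ->
      f t = J.1 + (J.2 - J.1) / (I.2 - I.1) * (t - I.1).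

(* The reduced diagram of f in F: its unique diagram with the fewest carets. *)
Definition reduced_diagram (R : realType) (f : R -> R) : tree * tree :=
  xget (Leaf, Leaf)
    [set D | represents D f /\
             forall D', represents D' f ->
               (ncarets R D.1 <= ncarets R D'.1)%N].

Definition carets_F (R : realType) (f : R -> R) : nat :=
  ncarets R (reduced_diagram f).1.

Definition side_carets_F (R : realType) (f : R -> R) : nat :=
  (nside_carets R (reduced_diagram f).1 +
   nside_carets R (reduced_diagram f).2)%N.

Definition a_of (R : realType) (g : R -> R) : nat := carets_F (pi_C g).
Definition b_of (R : realType) (g : R -> R) : nat := carets_F (to_F (debris g)).
Definition c_of (R : realType) (g : R -> R) : nat :=
  side_carets_F (to_F (debris g)).

(* Main.v *)
Require Import Defs.
From mathcomp Require Import all_boot all_order all_algebra.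
From mathcomp Require Import all_classical all_reals all_analysis.
From mathcomp Require Import ring lra zify.
Import Order.TTheory GRing.Theory Num.Theory.
Import numFieldNormedType.Exports.

Set Implicit Arguments.
Unset Strict Implicit.
Unset Printing Implicit Defensive.

Local Open Scope classical_set_scope.
Local Open Scope ring_scope.

(** Call a standard dyadic interval bad for f if f does not map it affinely onto
    a standard dyadic interval.  The carets of the first tree of the reduced
    diagram of f are bad intervals, and the number of bad intervals, as well as
    the number of those touching 0 or 1, is subadditive under composition.

    A word is read from its last letter to its first, keeping g = sigma f \; d.
    Prepending w_i changes f only; x_0 commutes with sigma f, so that prepending
    it multiplies d by x_0; and x_1 sigma f = sigma f y with y = f^-1 x_1 f f',
    where f acts on [0, 1] and its translate f' on [1, 2].  On the unit interval
    f and f' live in intervals away from 0 and 1, so y has O(n) bad intervals, of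
    which O(1) touch the boundary.  The n factors of d give the quadratic bound
    on b and the linear bound on c. *)

(** * Dyadic addresses *)

Section Addresses.
Variable R : realType.
Implicit Types (f g : R -> R) (s u v : seq bool) (t : R) (T : tree) (B : seq (seq bool)).

(* An address s codes the standard dyadic interval that is the image of [0, 1]
   under scale s; its letters select a half of the interval, false the left one. *)
Fixpoint scale s t : R := if s is b :: s' then (b%:R + scale s' t) / 2 else t.

Lemma scale_cat s u t : scale (s ++ u) t = scale s (scale u t).
Proof. by elim: s => //= b s ->. Qed.

Lemma scale_itv s t : 0 <= t <= 1 -> 0 <= scale s t <= 1.
Proof. by move=> ht; elim: s => //= -[] s; rewrite /=; lra. Qed.

Lemma scale0_lt1 s : 0 <= scale s 0 < 1.
Proof. by elim: s => [|[] s] /=; lra. Qed.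

Lemma scaleE s t : scale s t = scale s 0 + (scale s 1 - scale s 0) * t.
Proof. by elim: s => [|b s IH] /=; [|rewrite {1}IH]; lra. Qed.

Lemma scale_width s : scale s 0 < scale s 1.
Proof. by elim: s => [|b s IH] /=; lra. Qed.

Let itv0 : 0 <= (0 : R) <= 1. Proof. by lra. Qed.
Let itv1 : 0 <= (1 : R) <= 1. Proof. by lra. Qed.

(** The image of a nonempty address lies in one half of [0, 1], which rules out the empty address.
    The first letter is read off from the half containing the left endpoint. *)
Lemma scale_eq_inj s u :
  (forall t, 0 <= t <= 1 -> scale s t = scale u t) -> s = u.
Proof.
elim: s u => [|b s IH] [|c u] // H.
- move: (H _ itv0) (H _ itv1) (scale_itv u itv0) (scale_itv u itv1).
  by clear; rewrite /=; case: c => /= *; exfalso; lra.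
- move: (H _ itv0) (H _ itv1) (scale_itv s itv0) (scale_itv s itv1).
  by clear; rewrite /=; case: b => /= *; exfalso; lra.
have Ebc : b = c.
  move: (H _ itv0) (scale0_lt1 s) (scale0_lt1 u); clear; rewrite /=.
  by case: b; case: c => //= *; exfalso; lra.
by congr (_ :: _) => //; apply: IH => t /H /=; rewrite Ebc; lra.
Qed.

(** Since [scale s] is the increasing affine parametrisation of its interval, comparing
    parametrisations expresses affinity and the image interval at once. A bad interval is one
    without any such [u]. *)
Definition good f s u := forall t, 0 <= t <= 1 -> f (scale s t) = scale u t.

Lemma good_cat f s u v : good f s u -> good f (s ++ v) (u ++ v).
Proof. by move=> H t ht; rewrite !scale_cat H // scale_itv. Qed.

Lemma good_comp f g s u v : good f s u -> good g u v -> good (f \; g) s v.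
Proof. by move=> H1 H2 t ht /=; rewrite H1 // H2. Qed.

Lemma good_inv f g s u : cancel f g -> good f s u -> good g u s.
Proof. by move=> fK H t ht; rewrite -H. Qed.

Lemma good_eq_r f s u v : good f s u -> good f s v -> u = v.
Proof. by move=> H1 H2; apply: scale_eq_inj => t ht; rewrite -H1 // H2. Qed.

Lemma good_eq_l f s u v : injective f -> good f s v -> good f u v -> s = u.
Proof.
by move=> fI H1 H2; apply: scale_eq_inj => t ht; apply: fI; rewrite H1 // H2.
Qed.

(** [B] may contain good addresses too, so the number of bad intervals is bounded without deciding
    which ones are bad. *)
Definition covers f B := forall s, s \in B \/ exists u, good f s u.

(** The root [[::]] counts as a side address, whereas [nside_carets] leaves it out; bounds on [side]
    therefore overestimate. *)
Definition side s : bool :=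
  (scale s 0 <= 0 <= scale s 1) || (scale s 0 <= 1 <= scale s 1).

Lemma side_good f s u : f 0 = 0 -> f 1 = 1 -> good f s u -> side s -> side u.
Proof.
move=> f0E f1E H; rewrite /side.
move: (H _ itv0) (H _ itv1) (scale_itv s itv0) (scale_itv s itv1).
move: (scale_itv u itv0) (scale_itv u itv1) => h1 h2 h3 h4 h5 h6 /orP[h|h].
  have e : scale s 0 = 0 by lra.
  by move: h3 h4; rewrite e f0E; lra.
have e : scale s 1 = 1 by lra.
by move: h3 h4; rewrite e f1E; lra.
Qed.

(** Besides the two bounds, this records what makes them subadditive: injectivity makes preimages of
    intervals unique, and the fixed endpoints keep side intervals on the side. *)
Definition complexity f (n m : nat) : Prop :=
  [/\ f 0 = 0, f 1 = 1, injective f &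
    exists B, [/\ covers f B, (size B <= n)%N & (count side B <= m)%N]].

Lemma complexity_le f n m n' m' : (n <= n')%N -> (m <= m')%N ->
  complexity f n m -> complexity f n' m'.
Proof.
move=> hn hm [a b c [B [h1 h2 h3]]]; split=> //; exists B; split=> //.
  exact: leq_trans hn.
exact: leq_trans hm.
Qed.

Lemma complexity_id : complexity id 0 0.
Proof. by split=> //; exists [::]; split=> // s; right; exists s. Qed.

(** An interval bad for the product is either bad for [f], or carried by [f] onto an interval bad
    for [g]. The latter has at most one preimage, and a side preimage has a side image. *)
Lemma complexity_comp f g n1 m1 n2 m2 : complexity f n1 m1 ->
  complexity g n2 m2 -> complexity (f \; g) (n1 + n2) (m1 + m2).
Proof.
move=> [f0 f1 fI [B1 [c1 s1 k1]]] [g0 g1 gI [B2 [c2 s2 k2]]].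
split=> /=; [by rewrite f0|by rewrite f1|by move=> x y /= /gI/fI|].
(* The partial inverse of the action of [f] on addresses; [pmap] then discards the members of [B2]
   without a preimage. *)
pose pre u : option (seq bool) :=
  if pselect (exists s, good f s u) is left e then Some (projT1 (cid e)) else None.
have preP s u : good f s u -> pre u = Some s.
  rewrite /pre => H; case: pselect => [e|]; last by case; exists s.
  by congr Some; case: cid => v /= /good_eq_l; apply.
have preE s u : pre u = Some s -> good f s u.
  by rewrite /pre; case: pselect => // e [<-]; case: cid.
exists (B1 ++ pmap pre B2); split.
- move=> s; rewrite mem_cat; case: (c1 s) => [->|[u fsu]]; first by left.
  case: (c2 u) => [uB|[v guv]]; last by right; exists v; exact: good_comp guv.
  by left; apply/orP; right; rewrite mem_pmap -(preP _ _ fsu) map_f.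
- rewrite size_cat leq_add// size_pmap (leq_trans _ s2)//.
  by rewrite count_size.
- rewrite count_cat leq_add//; apply: leq_trans k2.
  elim: B2 {c2 s2} => //= u B IH; case E: (pre u) => [s|] /=; last first.
    exact: leq_trans (leq_addl _ _).
  rewrite leq_add//; case: (boolP (side s)) => // ss.
  by rewrite (side_good f0 f1 (preE _ _ E) ss).
Qed.

Definition half_copy (b : bool) f t : R := (b%:R + f (2 * t - b%:R)) / 2.

(** Intervals in the other half are fixed pointwise, those in the half [b] behave as for [f], and
    only the root is added. *)
Lemma covers_half_copy b f B : (forall t, ~~ (0 < t < 1) -> f t = t) ->
  covers f B -> covers (half_copy b f) ([::] :: map (cons b) B).
Proof.
move=> fid cf [|c s]; first by left.
have [->|nbc] := eqVneq c b; last first.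
  right; exists (c :: s) => t ht; rewrite /half_copy /=.
  have := scale_itv s ht => hs; rewrite fid; first lra.
  by move: nbc; case: (b); case: (c) => //=; lra.
case: (cf s) => [sB|[u su]]; first by left; rewrite inE map_f// orbT.
right; exists (b :: u) => t ht; rewrite /half_copy /=.
by rewrite (_ : 2 * _ - _ = scale s t) ?su//; lra.
Qed.

End Addresses.

(** * Tree diagrams *)

Fixpoint leaf_addr (T : tree) : seq (seq bool) :=
  if T is Node l r then
    map (cons false) (leaf_addr l) ++ map (cons true) (leaf_addr r)
  else [:: [::]].

Fixpoint node_addr (T : tree) : seq (seq bool) :=
  if T is Node l r then
    [::] :: map (cons false) (node_addr l) ++ map (cons true) (node_addr r)
  else [::].

Lemma cons_inj (A : Type) (a : A) : injective (cons a).
Proof. by move=> s t []. Qed.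

Lemma mem_map_cons b c s (L : seq (seq bool)) :
  (b :: s \in map (cons c) L) = (b == c) && (s \in L).
Proof.
have [->|ne] := eqVneq b c; first by rewrite (mem_map (@cons_inj _ c)).
by apply/mapP => -[x _ [/eqP]]; rewrite (negbTE ne).
Qed.

Lemma nil_notin_map_cons c (L : seq (seq bool)) : ([::] \in map (cons c) L) = false.
Proof. by apply/mapP => -[]. Qed.

Lemma uniq_map_cons_cat (L M : seq (seq bool)) :
  uniq (map (cons false) L ++ map (cons true) M) = uniq L && uniq M.
Proof.
rewrite cat_uniq !(map_inj_uniq (@cons_inj _ _)).
rewrite (_ : has _ _ = false) //; apply/hasPn => _ /mapP[s _ ->].
by rewrite /= mem_map_cons.
Qed.

Lemma uniq_leaf_addr T : uniq (leaf_addr T).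
Proof. by elim: T => //= l IHl r IHr; rewrite uniq_map_cons_cat IHl. Qed.

Lemma uniq_node_addr T : uniq (node_addr T).
Proof.
elim: T => //= l IHl r IHr.
by rewrite uniq_map_cons_cat IHl IHr mem_cat !nil_notin_map_cons.
Qed.

Lemma size_leaf_addr T : size (leaf_addr T) = (size (node_addr T)).+1.
Proof.
by elim: T => //= l IHl r IHr; rewrite !size_cat !size_map IHl IHr addnS.
Qed.

Lemma nil_leaf T : [::] \in leaf_addr T -> T = Leaf.
Proof. by case: T => //= l r; rewrite mem_cat !nil_notin_map_cons. Qed.

(** Deletion of an exposed caret, that is, one whose two children are leaves. *)
Lemma merge_leaves T s :
  rcons s false \in leaf_addr T -> rcons s true \in leaf_addr T ->
  exists T' L M, leaf_addr T = L ++ rcons s false :: rcons s true :: M /\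
                 leaf_addr T' = L ++ s :: M.
Proof.
elim: T s => [|l IHl r IHr] [|b s] //=; rewrite !mem_cat !mem_map_cons /=.
  rewrite orbF => /nil_leaf -> /nil_leaf ->.
  by exists Leaf, [::], [::].
case: b => /= h0 h1.
  have [T' [L [M [E E']]]] := IHr _ h0 h1.
  exists (Node l T'), (map (cons false) (leaf_addr l) ++ map (cons true) L).
  exists (map (cons true) M).
  by rewrite /= E E' !map_cat -!catA.
rewrite !orbF in h0 h1; have [T' [L [M [E E']]]] := IHl _ h0 h1.
exists (Node T' r), (map (cons false) L).
exists (map (cons false) M ++ map (cons true) (leaf_addr r)).
by rewrite /= E E' !map_cat -!catA.
Qed.

(** Going down from [s] through internal nodes must stop, at a caret whose children are both
    leaves. *)
Lemma exposed_caret T s : s \in node_addr T ->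
  exists p, rcons (s ++ p) false \in leaf_addr T /\
            rcons (s ++ p) true \in leaf_addr T.
Proof.
elim: T s => //= l IHl r IHr s; rewrite inE mem_cat.
case: s => [_ /=|b s]; last first.
  rewrite /= !mem_map_cons; case: b => /= h.
    have [p [h0 h1]] := IHr _ h; exists p.
    by rewrite !mem_cat !mem_map_cons /= h0 h1.
  rewrite orbF in h; have [p [h0 h1]] := IHl _ h; exists p.
  by rewrite !mem_cat !mem_map_cons /= h0 h1.
case: l IHl => [_|l1 l2 IHl].
  case: r IHr => [_|r1 r2 IHr]; first by exists [::].
  have [p [h0 h1]] := IHr [::] isT; exists (true :: p).
  by split; rewrite /= inE mem_map_cons /= ?h0 ?h1.
have [p [h0 h1]] := IHl [::] isT; exists (false :: p).
by split; rewrite [rcons _ _]/= mem_cat mem_map_cons eqxx andTb ?h0 ?h1.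
Qed.

Lemma node_or_below_leaf T s : s \in node_addr T \/
  exists p q, s = p ++ q /\ p \in leaf_addr T.
Proof.
elim: T s => [|l IHl r IHr] s; first by right; exists [::], s.
case: s => [|[] s]; first by left.
  have [h|[p [q [-> h]]]] := IHr s; [left|right; exists (true :: p), q; split=> //].
    by rewrite inE mem_cat !mem_map_cons h.
  by rewrite mem_cat !mem_map_cons h.
have [h|[p [q [-> h]]]] := IHl s; [left|right; exists (false :: p), q; split=> //].
  by rewrite inE mem_cat !mem_map_cons h.
by rewrite mem_cat !mem_map_cons h.
Qed.

Lemma uniq_split (A : eqType) (x : A) L L' M M' :
  uniq (L ++ x :: M) -> L ++ x :: M = L' ++ x :: M' -> L = L' /\ M = M'.
Proof.
move=> U E; have U' := U; rewrite E in U'.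
have ind N P : uniq (N ++ x :: P) -> index x (N ++ x :: P) = size N.
  rewrite cat_uniq /= negb_or => /and3P[_ /andP[xN _] _].
  by rewrite index_cat (negbTE xN) /= eqxx addn0.
have sz : size L = size L' by rewrite -(ind _ _ U) -(ind _ _ U') E.
by move/eqP: E; rewrite eqseq_cat // => /andP[/eqP -> /eqP[->]].
Qed.

Lemma zip_map2 (A B C D : Type) (f : A -> C) (g : B -> D) L M :
  zip (map f L) (map g M) = [seq (f p.1, g p.2) | p <- zip L M].
Proof. by elim: L M => [|x L IH] [|y M] //=; rewrite IH. Qed.

(** * Reduced diagrams and bad intervals *)

Section Diagrams.
Variable R : realType.
Implicit Types (f g : R -> R) (s u v : seq bool) (t : R) (T : tree) (B : seq (seq bool)).

(** The root interval is arbitrary because [leaves] and [carets] recurse into its halves. *)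
Let dyint (a b : R) s : R * R :=
  (a + (b - a) * scale s 0, a + (b - a) * scale s 1).

Lemma dyint_nil (a b : R) : dyint a b [::] = (a, b).
Proof. by rewrite /dyint /= mulr0 mulr1 addr0 addrC subrK. Qed.

Lemma dyint_half (a b : R) c s : dyint a b (c :: s) =
  if c then dyint ((a + b) / 2) b s else dyint a ((a + b) / 2) s.
Proof. by rewrite /dyint /=; case: c => /=; congr pair; field. Qed.

Lemma leavesE T (a b : R) : leaves T a b = map (dyint a b) (leaf_addr T).
Proof.
elim: T a b => [|l IHl r IHr] a b /=; first by rewrite dyint_nil.
rewrite map_cat IHl IHr -!map_comp.
by congr (_ ++ _); apply: eq_map => s; rewrite /= dyint_half.
Qed.

Lemma caretsE T (a b : R) : carets T a b = map (dyint a b) (node_addr T).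
Proof.
elim: T a b => [|l IHl r IHr] a b //=.
rewrite dyint_nil map_cat IHl IHr -!map_comp.
by congr (_ :: _ ++ _); apply: eq_map => s; rewrite /= dyint_half.
Qed.

Lemma dyint01 s : dyint 0 1 s = (scale s (0 : R), scale s 1).
Proof. by rewrite /dyint !subr0 !mul1r !add0r. Qed.

Lemma ncaretsE T : ncarets R T = size (node_addr T).
Proof. by rewrite /ncarets caretsE size_map. Qed.

Lemma nside_caretsE T : nside_carets R T = count (@side R) (behead (node_addr T)).
Proof.
rewrite /nside_carets caretsE behead_map count_map.
by apply: eq_count => s; rewrite /= /side subr0 !mul1r !add0r.
Qed.

Lemma representsE D f : represents D f <->
  size (leaf_addr D.1) = size (leaf_addr D.2) /\
  forall s u, (s, u) \in zip (leaf_addr D.1) (leaf_addr D.2) -> good f s u.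
Proof.
rewrite /represents !leavesE !size_map zip_map2.
(* The endpoint formula is [good] after the affine change of parameter from the interval of [s] to
   [0, 1]. *)
have key s u : (forall t, (dyint 0 1 s).1 <= t <= (dyint 0 1 s).2 ->
  f t = (dyint 0 1 u).1 + ((dyint 0 1 u).2 - (dyint 0 1 u).1) /
    ((dyint 0 1 s).2 - (dyint 0 1 s).1) * (t - (dyint 0 1 s).1)) <-> good f s u.
  rewrite !dyint01 /=; have w := scale_width R s.
  have w0 : scale s 1 - scale s 0 != 0 :> R by rewrite subr_eq0 gt_eqF.
  split=> H t ht.
    rewrite H [scale s t]scaleE; last by nra.
    by rewrite [RHS]scaleE; field.
  have := H ((t - scale s 0) / (scale s 1 - scale s 0)).
  rewrite [scale s (_ / _)]scaleE mulrCA divff // mulr1 [_ + (t - _)]addrC subrK => ->.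
    by rewrite [scale u (_ / _)]scaleE; field.
  by rewrite divr_ge0 ?ler_pdivrMr ?mul1r; lra.
split=> -[-> H]; split=> // s u.
  by move=> su; apply/key; apply: (H (dyint 0 1 s) (dyint 0 1 u)); apply/mapP; exists (s, u).
by move=> /mapP[[s' u'] /= su [-> ->]]; apply/key/H.
Qed.

Definition minimal_diagram (D : tree * tree) f :=
  represents D f /\ forall D', represents D' f -> (ncarets R D.1 <= ncarets R D'.1)%N.

(** The default [(Leaf, Leaf)] has no carets, so upper bounds on caret counts hold in that case
    too. *)
Lemma reduced_diagramP f :
  minimal_diagram (reduced_diagram f) f \/ reduced_diagram f = (Leaf, Leaf).
Proof. by rewrite /reduced_diagram; case: xgetP => [D -> H|_]; [left|right]. Qed.

(** If a caret were good, so would be an exposed caret below it. The two leaves of the latter are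
    then sent to the halves of one standard interval, so a caret cancels in both trees, against
    minimality. *)
Lemma minimal_node_bad D f s u :
  minimal_diagram D f -> s \in node_addr D.1 -> ~ good f s u.
Proof.
case: D => T1 T2 [/representsE /= [sz H] min] /exposed_caret[p [h0 h1]] /(good_cat p).
move: (s ++ p) (u ++ p) h0 h1 => {}s {}u h0 h1 gsu.
have [T1' [L1 [M1 [E1 E1']]]] := merge_leaves h0 h1.
(* The leaves of [T2] are cut at the position of the exposed caret of [T1]; [a] and [b] are the
   leaves matched with its children. *)
have [a [b [L2 [M2 [E2 sL sM]]]]] : exists a b L2 M2,
  [/\ leaf_addr T2 = L2 ++ a :: b :: M2, size L1 = size L2 & size M1 = size M2].
  have szT2 : size (leaf_addr T2) = (size L1 + (size M1).+2)%N.
    by rewrite -sz E1 size_cat.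
  have hd := cat_take_drop (size L1) (leaf_addr T2).
  have szd : size (drop (size L1) (leaf_addr T2)) = (size M1).+2.
    by rewrite size_drop szT2 addKn.
  have szt : size (take (size L1) (leaf_addr T2)) = size L1.
    by rewrite size_takel // szT2 leq_addr.
  case: (drop _ _) szd hd => [|a [|b M2]] // [szM] hd.
  by exists a, b, (take (size L1) (leaf_addr T2)), M2.
have zE : zip (leaf_addr T1) (leaf_addr T2) =
    zip L1 L2 ++ (rcons s false, a) :: (rcons s true, b) :: zip M1 M2.
  by rewrite E1 E2 zip_cat.
have ga : good f (rcons s false) a by apply: H; rewrite zE mem_cat !inE eqxx orbT.
have gb : good f (rcons s true) b by apply: H; rewrite zE mem_cat !inE eqxx !orbT.
have aE : a = rcons u false.
  by apply: good_eq_r ga _; rewrite -!cats1; exact: good_cat.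
have bE : b = rcons u true.
  by apply: good_eq_r gb _; rewrite -!cats1; exact: good_cat.
have [T2' [L [M [E2' E3]]]] : exists T' L M,
    leaf_addr T2 = L ++ rcons u false :: rcons u true :: M /\
    leaf_addr T' = L ++ u :: M.
  by apply: merge_leaves; rewrite E2 aE bE mem_cat !inE eqxx !orbT.
have U := uniq_leaf_addr T2; rewrite E2 aE bE in U.
(* Leaf addresses are distinct, so the merge in [T2] takes place at the position of the merge in
   [T1] and the other leaves stay matched. *)
have [LE [ME]] : L2 = L /\ rcons u true :: M2 = rcons u true :: M.
  by apply: (uniq_split U); rewrite -E2' E2 aE bE.
have /min : represents (T1', T2') f.
  apply/representsE; rewrite /= E1' E3 -LE -ME !size_cat /= sL sM; split=> //.
  move=> s' u'; rewrite zip_cat // mem_cat inE => /or3P[h|/eqP[-> ->] //|h].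
    by apply: H; rewrite zE mem_cat h.
  by apply: H; rewrite zE mem_cat !inE h !orbT.
rewrite /= !ncaretsE -ltnS -!size_leaf_addr E1 E1' !size_cat /=; lia.
Qed.

Lemma represents_swap D f g : cancel f g -> represents D f -> represents (D.2, D.1) g.
Proof.
move=> fK /representsE[sz H]; apply/representsE; split=> //= s u su.
apply: (good_inv fK); apply: H; move: su.
elim: (leaf_addr D.1) (leaf_addr D.2) => [|x L IH] [|y M] //=.
by rewrite !inE => /orP[/eqP[-> ->]|/IH ->]; rewrite ?eqxx ?orbT.
Qed.

Lemma represents_ncarets D f : represents D f -> ncarets R D.1 = ncarets R D.2.
Proof.
by move=> /representsE[]; rewrite !size_leaf_addr !ncaretsE => -[].
Qed.

Lemma minimal_swap D f g : cancel f g -> cancel g f ->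
  minimal_diagram D f -> minimal_diagram (D.2, D.1) g.
Proof.
move=> fK gK [rD min]; split=> [|D' rD']; first exact: represents_swap rD.
rewrite /= -(represents_ncarets rD) (represents_ncarets rD').
by apply: (min (D'.2, D'.1)); exact: represents_swap rD'.
Qed.

Lemma minimal_covers D f B : minimal_diagram D f -> covers f B ->
  {subset node_addr D.1 <= B}.
Proof.
by move=> mD cB s sD; case: (cB s) => // -[u /(minimal_node_bad mD sD)].
Qed.

(** The carets of the first tree have distinct addresses, and all of these lie in any list covering
    the bad intervals. *)
Lemma minimal_complexity D f n m : minimal_diagram D f -> complexity f n m ->
  (ncarets R D.1 <= n)%N /\ (nside_carets R D.1 <= m)%N.
Proof.
move=> mD [_ _ _ [B [cB sB kB]]]; have sub := minimal_covers mD cB.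
split.
  rewrite ncaretsE (leq_trans _ sB) //.
  exact: uniq_leq_size (uniq_node_addr _) sub.
rewrite nside_caretsE (leq_trans _ kB) // -!size_filter uniq_leq_size //.
  by rewrite filter_uniq// -drop1 drop_uniq ?uniq_node_addr.
move=> s; rewrite !mem_filter => /andP[-> /=] /mem_behead; exact: sub.
Qed.

Lemma carets_F_le f n m : complexity f n m -> (carets_F f <= n)%N.
Proof.
move=> c; rewrite /carets_F; have [mD|->] := reduced_diagramP f.
  by have [] := minimal_complexity mD c.
by rewrite ncaretsE.
Qed.

(** The second tree is the first tree of the swapped diagram, which is minimal for the inverse. *)
Lemma side_carets_F_le f g n m n' m' : cancel f g -> cancel g f ->
  complexity f n m -> complexity g n' m' -> (side_carets_F f <= m + m')%N.
Proof.
move=> fK gK cf cg; rewrite /side_carets_F; have [mD|->] := reduced_diagramP f.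
  have [_ h1] := minimal_complexity mD cf.
  have [_ h2] := minimal_complexity (minimal_swap fK gK mD) cg.
  exact: leq_add.
by rewrite !nside_caretsE.
Qed.

End Diagrams.

(** * Piecewise linear homeomorphisms *)

(* Splits on an innermost condition first, so that no condition contains another one. *)
Ltac split_ifs := repeat match goal with
  |- context [if ?c then _ else _] =>
    lazymatch c with
    | context [if _ then _ else _] => fail
    | _ => case: (boolP c); rewrite -?ltNge -?leNgt => ? /=
    end
  end.

Section PiecewiseLinear.
Variable R : realType.
Implicit Types (f g : R -> R) (x y t c : R).

Lemma dyadicD x y : dyadic x -> dyadic y -> dyadic (x + y).
Proof.
move=> [m [n ->]] [m' [n' ->]]; exists (m * 2 ^+ n' + m' * 2 ^+ n), (n + n')%N.
rewrite intrD !intrM !rmorphXn /= exprD.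
by field; rewrite !expf_neq0.
Qed.

Lemma dyadicN x : dyadic x -> dyadic (- x).
Proof. by move=> [m [n ->]]; exists (- m), n; rewrite rmorphN mulNr. Qed.

Lemma dyadicM2 x : dyadic x -> dyadic (2 * x).
Proof. by move=> [m [n ->]]; exists (2 * m), n; rewrite intrM mulrA. Qed.

Lemma dyadic_half x : dyadic x -> dyadic (x / 2).
Proof.
by move=> [m [n ->]]; exists m, n.+1; rewrite exprSr invfM mulrA.
Qed.

Lemma dyadic1 : dyadic (1 : R).
Proof. by exists 1, 0%N; rewrite expr0 divr1. Qed.

Lemma affine_near_uniq f x a b a' b' :
  affine_near f x a b -> affine_near f x a' b' -> a = a'.
Proof.
move=> H H'; have E : \forall y \near x, a * y + b = a' * y + b'.
  by near do rewrite -(near H)// -(near H')//.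
have Ex := nbhs_singleton E.
have /filter_ex[z [/= zE zx]] : \forall z \near x^', a * z + b = a' * z + b' /\ z != x.
  near=> z; split; last by near: z; exact: nbhs_dnbhs_neq.
  by near: z; exact: (@cvg_within _ (nbhs x)).
have zx0 : z - x != 0 by rewrite subr_eq0.
by apply: (mulIf zx0); lra.
Unshelve. all: by end_near.
Qed.

(** The finite set [S] only has to contain the breakpoints. Preservation of dyadic numbers is
    included so that breakpoints pulled back through an inverse remain dyadic. *)
Definition plmap f : Prop :=
  [/\ {homo f : x y / x < y}, continuous f,
      forall x, dyadic x -> dyadic (f x) &
      exists S : set R, [/\ finite_set S, S `<=` @dyadic R &
        forall x, ~ S x -> exists (n : int) b, affine_near f x (2 ^ n) b]].

Definition plpair f g : Prop :=
  [/\ cancel f g, cancel g f, plmap f & plmap g].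

Lemma plpairC f g : plpair f g -> plpair g f.
Proof. by case. Qed.

(** Breakpoints of the product come from those of [f] and from the images under [f'] of those of
    [g]; slopes multiply, so exponents add. *)
Lemma plmap_comp f f' g : cancel f f' -> cancel f' f -> plmap f -> plmap f' ->
  plmap g -> plmap (f \; g).
Proof.
move=> fK fK' [fi fc fd [S [Sf Sd SP]]] [_ _ f'd _] [gi gc gd [S' [Sf' Sd' SP']]].
split.
- by move=> x y /fi/gi.
- by move=> x; apply: continuous_comp; [exact: fc|exact: gc].
- by move=> x /fd/gd.
exists (S `|` f' @` S'); split.
- by rewrite finite_setU; split=> //; exact: finite_image.
- by move=> x [/Sd//|[y /Sd'/f'd yd <-]].
move=> x /not_orP[/SP[n [b H]] xS'].
have [n' [b' H']] : exists (n : int) b, affine_near g (f x) (2 ^ n) b.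
  by apply: SP' => fxS; apply: xS'; exists (f x).
exists (n' + n), (2 ^ n' * b + b').
have K : \forall y \near x, g (f y) = 2 ^ n' * f y + b' := fc x _ H'.
near=> y; rewrite /= (near K y) //= (near H y) // expfzDr //; lra.
Unshelve. all: by end_near.
Qed.

Lemma plpair_comp f f' g g' : plpair f f' -> plpair g g' ->
  plpair (f \; g) (g' \; f').
Proof.
move=> [fK f'K pf pf'] [gK g'K pg pg']; split.
- by move=> x /=; rewrite gK fK.
- by move=> x /=; rewrite f'K g'K.
- exact: (plmap_comp fK).
- exact: (plmap_comp g'K).
Qed.

Lemma plmap_affine (n : int) c : dyadic c ->
  (forall x, dyadic x -> dyadic (2 ^ n * x)) -> plmap (fun x => 2 ^ n * x + c).
Proof.
move=> cd Hn; split.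
- by move=> x y xy; rewrite ltrD2r ltr_pM2l // exprz_gt0.
- by move=> x; apply: cvgD; [exact: mulrl_continuous|exact: cvg_cst].
- by move=> x xd; apply: dyadicD => //; exact: Hn.
- exists set0; split; [exact: finite_set0|exact: sub0set|move=> x _; exists n, c].
  exact: (@filterE _ (nbhs x)).
Qed.

Lemma plpair_shift c : dyadic c -> plpair (fun x => x + c) (fun x => x - c).
Proof.
move=> cd; split; [exact: addrK|exact: subrK| |].
- have /(plmap_affine cd) : forall x, dyadic x -> dyadic (2 ^ 0 * x).
    by move=> x xd; rewrite mul1r.
  by under eq_fun do rewrite mul1r.
- have /(plmap_affine (dyadicN cd)) : forall x, dyadic x -> dyadic (2 ^ 0 * x).
    by move=> x xd; rewrite mul1r.
  by under eq_fun do rewrite mul1r.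
Qed.

Lemma dyadic0 : dyadic (0 : R).
Proof. by rewrite -(subrr 1); apply: dyadicD; [|apply: dyadicN]; exact: dyadic1. Qed.

Lemma plpair_double : plpair (fun x => 2 * x) (fun x => x / 2).
Proof.
split; [by move=> x; field|by move=> x; field| |].
- have /(plmap_affine dyadic0) : forall x, dyadic x -> dyadic (2 ^ 1 * x) by exact: dyadicM2.
  by under eq_fun do rewrite addr0.
- have /(plmap_affine dyadic0) : forall x, dyadic x -> dyadic (2 ^ (-1) * x).
    by move=> x; rewrite mulrC; exact: dyadic_half.
  by under eq_fun do rewrite addr0 mulrC.
Qed.

(* x1 and f0 are products of bend, its inverse and their conjugates by translations. *)
Definition bend x : R := if x <= 0 then x else 2 * x.
Definition unbend x : R := if x <= 0 then x else x / 2.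

Lemma plpair_bend : plpair bend unbend.
Proof.
split.
- by move=> x; rewrite /bend /unbend; split_ifs; lra.
- by move=> x; rewrite /bend /unbend; split_ifs; lra.
- split.
  + by move=> x y xy; rewrite /bend; split_ifs; lra.
  + have -> : bend = (fun x : R => Num.max x (2 * x)).
      apply/funext => x; rewrite /bend /Num.max.
      by split_ifs; lra.
    move=> x; apply: (@continuous_max _ _ id); first exact: cvg_id.
    exact: mulrl_continuous.
  + by move=> x xd; rewrite /bend; case: ifP => // _; exact: dyadicM2.
  + exists [set 0]; split; [exact: finite_set1|by move=> _ ->; exact: dyadic0|].
    move=> x /eqP; rewrite neq_lt => /orP[x0|x0].
      exists 0, 0; near=> y; rewrite mul1r addr0 /bend ifT //.
      by apply/ltW; near: y; exact: lt_nbhsl.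
    exists 1, 0; near=> y; rewrite addr0 /bend ifF //.
    by apply/negbTE; rewrite -ltNge; near: y; exact: lt_nbhsr.
- split.
  + by move=> x y xy; rewrite /unbend; split_ifs; lra.
  + have -> : unbend = (fun x : R => Num.min x (2^-1 * x)).
      apply/funext => x; rewrite /unbend /Num.min.
      by split_ifs; lra.
    move=> x; apply: (@continuous_min _ _ id); first exact: cvg_id.
    exact: mulrl_continuous.
  + by move=> x xd; rewrite /unbend; case: ifP => // _; exact: dyadic_half.
  + exists [set 0]; split; [exact: finite_set1|by move=> _ ->; exact: dyadic0|].
    move=> x /eqP; rewrite neq_lt => /orP[x0|x0].
      exists 0, 0; near=> y; rewrite mul1r addr0 /unbend ifT //.
      by apply/ltW; near: y; exact: lt_nbhsl.
    exists (-1), 0; near=> y; rewrite addr0 /unbend ifF 1?mulrC //.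
    by apply/negbTE; rewrite -ltNge; near: y; exact: lt_nbhsr.
Unshelve. all: by end_near.
Qed.

Lemma plpair_conj_shift f g c : dyadic c -> plpair f g ->
  plpair (fun x => f (x - c) + c) (fun x => g (x - c) + c).
Proof.
move=> cd fg; have sc := plpair_shift cd.
exact: plpair_comp (plpair_comp (plpairC sc) fg) sc.
Qed.

Lemma plpair_half_copy f g : plpair f g -> plpair (half_copy true f) (half_copy true g).
Proof.
move=> fg; have h := plpair_comp (plpairC (plpair_shift dyadic1)) fg.
have {}h := plpair_comp (plpair_comp plpair_double h) (plpair_shift dyadic1).
have := plpair_comp h (plpairC plpair_double).
by congr plpair; apply/funext => x; rewrite /half_copy /= addrC.
Qed.

Lemma plpair_x0 : plpair (@x0 R) (fun x => x - 1).
Proof. exact: plpair_shift dyadic1. Qed.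

Lemma plpair_ext f g f' : plpair f g -> f =1 f' -> exists g', plpair f' g'.
Proof. by move=> fg /funext <-; exists g. Qed.

Lemma plpair_x1 : exists g, plpair (@x1 R) g.
Proof.
have d2 : dyadic (2 : R) by exact: dyadicD dyadic1 dyadic1.
apply: plpair_ext (plpair_comp plpair_bend
  (plpair_conj_shift d2 (plpairC plpair_bend))) _ => x.
by rewrite /= /unbend /bend /x1; split_ifs; lra.
Qed.

Lemma plpair_f0 : exists g, plpair (@f0 R) g.
Proof.
(* Each factor acts on the output of the previous ones, so the corners sit at 0, 1/2, 3/4 and 1, the
   values of [f0] at its breakpoints. *)
have d2 := dyadic_half dyadic1; have d4 := dyadicD d2 (dyadic_half d2).
have h := plpair_comp plpair_bend (plpair_conj_shift d2 (plpairC plpair_bend)).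
have {}h := plpair_comp h (plpair_conj_shift d4 (plpairC plpair_bend)).
have {}h := plpair_comp h (plpair_conj_shift dyadic1 plpair_bend).
apply: plpair_ext h _ => x.
by rewrite /= /unbend /bend /f0; split_ifs; lra.
Qed.

Lemma plpair_PL2 f g : plpair f g -> PL2 f /\ finite_set (breakpoint f).
Proof.
move=> [fK gK [fi fc fd [S [Sf Sd SP]]] [_ gc _ _]].
have bS : breakpoint f `<=` S.
  move=> x bx; apply: contrapT => /SP[n [b H]].
  by apply: bx; exists (2 ^ n), b.
have bf : finite_set (breakpoint f) := sub_finite_set bS Sf.
have away A x : finite_set A -> nbhs x (~` (A `\ x)).
  move=> Af; apply: open_nbhs_nbhs; split=> [|[_ /=]//].
  apply: closed_openC; have : finite_set (A `\ x) by exact: finite_setD.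
  move: (A `\ x); apply/accessible_finite_set_closed/hausdorff_accessible.
  exact: Rhausdorff.
split=> //; split.
- by split=> //; exists g.
- move=> x bx; split; first exact/mem_set.
  exists (~` (breakpoint f `\ x)); first exact: away.
  apply/seteqP; split=> y /=; last by move=> ->; split=> // -[].
  by move=> [yb yB]; apply: contrapT => yx; apply: yb.
- by move=> x /bS/Sd.
- move=> x a b H.
  (* The point [x] may belong to [S], so the slope is read at a nearby point outside [S], where the
     same affine formula holds. *)
  have [z [zS zH]] : exists z, ~ S z /\ affine_near f z a b.
    apply: (@filter_ex _ x^'); near=> z; split; last first.
      by near: z; apply: nbhs_dnbhs; exact: near_join H.
    move=> Sz; have zx : z != x by near: z; exact: nbhs_dnbhs_neq.
    suff : ~ (S `\ x) z by apply; split=> //; exact/eqP.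
    by near: z; apply: nbhs_dnbhs; exact: away.
  have [n [c H']] := SP _ zS.
  by exists n; exact: affine_near_uniq zH H'.
Unshelve. all: by end_near.
Qed.

Lemma inverseE f g : cancel f g -> cancel g f -> inverse f = g.
Proof.
move=> fK gK; apply/funext => y; rewrite -[in LHS](gK y) /inverse pinvKV ?inE //.
by move=> ? ? _ _; exact: can_inj fK _ _.
Qed.

End PiecewiseLinear.

(** * Periodic extensions and the unit interval *)

Section PeriodicExtension.
Variable R : realType.
Implicit Types (f g h : R -> R) (t u x y : R).

(** The endpoints are fixed as well, whereas [thompsonF] prescribes values only outside the closed
    interval; [thompsonF_supp01] bridges the two. *)
Definition supp01 f := forall t, ~~ (0 < t < 1) -> f t = t.

Lemma supp01_0 f : supp01 f -> f 0 = 0.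
Proof. by apply; rewrite ltxx. Qed.

Lemma supp01_1 f : supp01 f -> f 1 = 1.
Proof. by apply; rewrite ltxx andbF. Qed.

Lemma supp01_inv f g : cancel f g -> supp01 f -> supp01 g.
Proof. by move=> fK sf t ht; rewrite -{1}(sf t ht) fK. Qed.

Lemma supp01_comp f g : supp01 f -> supp01 g -> supp01 (f \; g).
Proof. by move=> sf sg t ht /=; rewrite sf ?sg. Qed.

Lemma supp01_itv f t : {homo f : x y / x < y} -> supp01 f ->
  0 <= t < 1 -> 0 <= f t < 1.
Proof.
move=> fi sf /andP[t0 t1]; rewrite -[ltRHS](supp01_1 sf) fi // andbT.
move: t0; rewrite le_eqVlt => /orP[/eqP <-|/fi/ltW]; by rewrite supp01_0.
Qed.

Lemma sigmaE f (n : int) u : 0 <= u < 1 -> sigma f (n%:~R + u) = n%:~R + f u.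
Proof.
move=> u01; rewrite /sigma.
have -> : Num.floor (n%:~R + u) = n by apply: floor_def; rewrite intrD; lra.
by rewrite addrAC subrr add0r.
Qed.

Lemma floor_decomp u : exists (n : int) v, u = n%:~R + v /\ 0 <= v < 1.
Proof.
exists (Num.floor u), (u - (Num.floor u)%:~R); split; first by rewrite addrC subrK.
by have := floor_itv u; rewrite intrD; lra.
Qed.

Lemma sigma_id : sigma id = (id : R -> R).
Proof. by apply/funext => u; rewrite /sigma addrC subrK. Qed.

Lemma sigma_comp f g : {homo f : x y / x < y} -> supp01 f ->
  sigma f \; sigma g = sigma (f \; g).
Proof.
move=> fi sf; apply/funext => u /=; have [n [v [-> v01]]] := floor_decomp u.
by rewrite !sigmaE // supp01_itv.
Qed.

Lemma sigmaK f g : {homo f : x y / x < y} -> supp01 f -> cancel f g ->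
  cancel (sigma f) (sigma g).
Proof.
move=> fi sf fK u; rewrite -[LHS]/((sigma f \; sigma g) u) sigma_comp //.
by rewrite (_ : f \; g = id) ?sigma_id //; apply/funext.
Qed.

Lemma sigmaDz f u (m : int) : sigma f (u + m%:~R) = sigma f u + m%:~R.
Proof.
have [n [v [-> v01]]] := floor_decomp u.
by rewrite addrAC -intrD !sigmaE // intrD addrAC.
Qed.

Lemma sigmaD1 f u : sigma f (u + 1) = sigma f u + 1.
Proof. exact: (sigmaDz f u 1). Qed.

Lemma sigma01 f u : 0 <= u < 1 -> sigma f u = f u.
Proof. by move=> u01; have := sigmaE f 0 u01; rewrite !add0r. Qed.

Lemma sigma_homo f : {homo f : x y / x < y} -> supp01 f ->
  {homo sigma f : x y / x < y}.
Proof.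
move=> fi sf x y; have [n [v [-> v01]]] := floor_decomp x.
have [m [w [-> w01]]] := floor_decomp y.
rewrite !sigmaE // => xy; have := supp01_itv fi sf v01; have := supp01_itv fi sf w01.
have [nm|mn|nm] := ltgtP n m.
- have : (n + 1)%:~R <= m%:~R :> R by rewrite ler_int lezD1.
  by rewrite intrD; lra.
- have : (m + 1)%:~R <= n%:~R :> R by rewrite ler_int lezD1.
  by rewrite intrD; lra.
- move=> _ _; rewrite nm ltrD2l; apply: fi; by move: xy; rewrite nm ltrD2l.
Qed.

Lemma x0_sigma f : @x0 R \; sigma f = sigma f \; @x0 R.
Proof. by apply/funext => u; rewrite /= /x0 sigmaD1. Qed.

(** Left of 0 the map [x1] is the identity, and right of 1 it is a unit translation, which commutes
    with [sigma f]. On [0, 1) the doubled point lies in [0, 2), where [sigma f] is [f] followed by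
    its translate to [1, 2]. *)
Lemma x1_sigma f g : {homo f : x y / x < y} -> supp01 f -> cancel f g ->
  @x1 R \; sigma f =
  sigma f \; (g \; @x1 R \; f \; (fun t => f (t - 1) + 1)).
Proof.
move=> fi sf fK; have sg := supp01_inv fK sf; have si := sigma_homo fi sf.
have sn (n : int) : sigma f n%:~R = n%:~R.
  by have := @sigmaE f n 0; rewrite addr0 (supp01_0 sf) addr0 => -> //; lra.
apply/funext => u /=; have [u01|] := boolP (0 <= u < 1).
  rewrite (sigma01 _ u01) fK /x1; have -> : (u <= 1) = true by lra.
  have -> : (if u <= 0 then u else 2 * u) = 2 * u.
    by case: ifP => // u0; lra.
  have [u2|u2] := ltP (2 * u) 1.
    have v01 : 0 <= 2 * u < 1 by lra.
    rewrite sigma01 //; have h := supp01_itv fi sf v01.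
    by rewrite [f (_ - 1)]sf; lra.
  rewrite [f (2 * u)]sf; last by lra.
  by rewrite -{1}(subrK 1 (2 * u)) sigmaD1 sigma01 //; lra.
rewrite negb_and -ltNge -leNgt => /orP[u0|u1].
  have := si _ _ u0; rewrite (sn 0) => s0.
  rewrite [g _]sg; last by lra.
  have x1E v : v < 0 -> @x1 R v = v by rewrite /x1; case: ltgtP.
  by rewrite !x1E // !sf; lra.
have s1 : 1 <= sigma f u.
  by move: u1; rewrite le_eqVlt => /orP[/eqP <-|/si/ltW]; rewrite (sn 1).
rewrite [g _]sg; last by lra.
have x1E v : 1 <= v -> @x1 R v = v + 1.
  by move=> v1; rewrite /x1; case: ifPn => [|_]; [lra|case: ifPn; lra].
by rewrite !x1E // sigmaD1 !sf; lra.
Qed.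

End PeriodicExtension.

(** * The identification of the line with the open unit interval *)

Section LineToUnit.
Variable R : realType.
Implicit Types (d e f : R -> R) (t u v : R).
Local Notation L := (@line_to_unit R).

Lemma line_to_unit01 u : 0 <= u < 1 -> L u = 1 / 2 + u / 4.
Proof.
move=> u01; rewrite /line_to_unit; have [-> _] := andP u01.
have -> : Num.truncn u = 0%N by apply: truncn_def; rewrite mulr1n.
by rewrite expr1 expr2 invfM subr0; lra.
Qed.

(** A unit step to the right halves the distance to 1. Together with [nonneg_ind] and the symmetry
    [line_to_unitN], this recursion replaces the explicit formula. *)
Lemma line_to_unitD1 u : 0 <= u -> L (u + 1) = 1 / 2 + L u / 2.
Proof.
move=> u0; rewrite /line_to_unit u0 (_ : 0 <= u + 1); last by lra.
have -> : Num.truncn (u + 1) = (Num.truncn u).+1.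
  by apply: truncn_def; have := truncn_itv u0; rewrite -!natr1; lra.
move: (Num.truncn u) => k.
rewrite -[k.+1%:R]natr1 [2 ^+ k.+3]exprS [2 ^+ k.+2]exprS !invfM.
by move: (2 ^+ k.+1)^-1 => p; lra.
Qed.

Lemma line_to_unitN u : u <= 0 -> L u = 1 - L (- u).
Proof.
rewrite le_eqVlt => /orP[/eqP ->|u0].
  by rewrite oppr0 line_to_unit01; lra.
by rewrite /line_to_unit [0 <= u]leNgt u0 /= ifT //; lra.
Qed.

Lemma nonneg_ind (P : R -> Prop) : (forall u, 0 <= u < 1 -> P u) ->
  (forall u, 0 <= u -> P u -> P (u + 1)) -> forall u, 0 <= u -> P u.
Proof.
move=> P0 PS u u0; have := truncn_itv u0; move: (Num.truncn u) => n.
elim: n u u0 => [|n IH] u u0 hu; first by apply: P0; rewrite mulr1n in hu.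
rewrite -!natr1 in IH hu; have n0 : 0 <= n%:R :> R by [].
by rewrite -(subrK 1 u); apply: PS; [|apply: IH]; lra.
Qed.

Lemma line_to_unit_ge0 u : 0 <= u -> 1 / 2 <= L u < 1.
Proof.
elim/nonneg_ind => {}u u0; first by rewrite line_to_unit01 //; lra.
by rewrite line_to_unitD1 //; lra.
Qed.

Lemma line_to_unit_itv u : 0 < L u < 1.
Proof.
have [u0|u0] := leP 0 u; first by have := line_to_unit_ge0 u0; lra.
rewrite line_to_unitN; last exact: ltW.
by have := @line_to_unit_ge0 (- u); lra.
Qed.

Lemma line_to_unit_homo : {homo L : u v / u < v}.
Proof.
have pos u : 0 <= u -> forall v, u < v -> L u < L v.
  elim/nonneg_ind => {}u.
    move=> u01 v uv; rewrite line_to_unit01 //.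
    have [v1|v1] := ltP v 1; first by rewrite line_to_unit01; lra.
    rewrite -(subrK 1 v) line_to_unitD1; last by lra.
    by have := @line_to_unit_ge0 (v - 1); lra.
  move=> u0 IH v uv; rewrite -(subrK 1 v) !line_to_unitD1 //; last by lra.
  by have := IH (v - 1); lra.
move=> u v uv; have [u0|u0] := leP 0 u; first exact: pos.
have [v0|v0] := ltP v 0.
  rewrite line_to_unitN 1?[L v]line_to_unitN; try lra.
  by have := @pos (- v) _ (- u); lra.
rewrite line_to_unitN; last by lra.
have := line_to_unit_ge0 v0; have := @pos 0 _ (- u).
by rewrite line_to_unit01; lra.
Qed.

Lemma line_to_unit_inj : injective L.
Proof.
move=> u v; have [/line_to_unit_homo|/line_to_unit_homo|//] := ltgtP u v => h E;
  by move: h; rewrite E ltxx.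
Qed.

Lemma line_to_unit_surj t : 0 < t < 1 -> exists u, L u = t.
Proof.
(* Undoing a unit step replaces [s] by [2 * s - 1] and doubles the distance to 1, so [n] bounds the
   number of steps until [s] drops below 3/4. *)
have pos n s : 1 / 2 <= s < 1 -> 1 <= 2 ^+ n * (1 - s) -> exists2 u, 0 <= u & L u = s.
  elim: n s => [|n IH] s hs hn; first by move: hn; rewrite expr0; lra.
  have [s34|s34] := ltP s (3 / 4).
    by exists (4 * s - 2); [lra|rewrite line_to_unit01; lra].
  have [||u u0 uE] := IH (2 * s - 1); [lra|move: hn; rewrite exprS; lra|].
  by exists (u + 1); [lra|rewrite line_to_unitD1 // uE; lra].
have {}pos s : 1 / 2 <= s < 1 -> exists2 u, 0 <= u & L u = s.
  move=> hs; set n := (Num.truncn ((1 - s)^-1)).+1.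
  apply: (pos n) => //; have s1 : 0 < 1 - s by lra.
  rewrite -ler_pdivrMr // mul1r ltW // (lt_trans (truncnS_gt _)) //.
  by rewrite -natrX ltr_nat ltn_expl.
move=> t01; have [t2|t2] := leP (1 / 2) t.
  by have [|u _ <-] := pos t; [lra|exists u].
have [|u u0 uE] := pos (1 - t); first lra.
by exists (- u); rewrite line_to_unitN ?opprK ?uE; lra.
Qed.

Lemma line_to_unitK : cancel L (@unit_to_line R).
Proof.
move=> u; rewrite /unit_to_line /inverse pinvKV ?inE //.
by move=> ? ? _ _; exact: line_to_unit_inj.
Qed.

Lemma to_F_line d u : to_F d (L u) = L (d u).
Proof. by rewrite /to_F line_to_unit_itv line_to_unitK. Qed.

Lemma to_F_supp01 d : supp01 (to_F d).
Proof. by move=> t /negbTE t01; rewrite /to_F t01. Qed.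

Lemma to_F_eq d f : supp01 f -> (forall u, f (L u) = L (d u)) -> to_F d = f.
Proof.
move=> sf H; apply/funext => t; have [/line_to_unit_surj[u <-]|nt] := boolP (0 < t < 1).
  by rewrite to_F_line H.
by rewrite to_F_supp01 // sf.
Qed.

Lemma to_F_id : to_F id = (id : R -> R).
Proof. exact: to_F_eq. Qed.

Lemma to_F_comp d e : to_F (d \; e) = to_F d \; to_F e.
Proof.
apply: to_F_eq => [|u]; last by rewrite /= !to_F_line.
exact: supp01_comp (@to_F_supp01 d) (@to_F_supp01 e).
Qed.

Lemma to_FK d e : cancel d e -> cancel (to_F d) (to_F e).
Proof.
move=> dK t; rewrite -[LHS]/((to_F d \; to_F e) t) -to_F_comp.
by rewrite (_ : d \; e = id) ?to_F_id //; apply/funext.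
Qed.

Lemma f0_supp01 : supp01 (@f0 R).
Proof. by move=> t ht; rewrite /f0; split_ifs; lra. Qed.

Lemma half_copy_supp01 b f : supp01 f -> supp01 (half_copy b f).
Proof. by move=> sf t ht; rewrite /half_copy sf; case: b => /=; lra. Qed.

Lemma f1_supp01 : supp01 (@f1 R).
Proof. exact: (half_copy_supp01 true f0_supp01). Qed.

Lemma to_F_x0 : to_F (@x0 R) = @f0 R.
Proof.
apply: to_F_eq f0_supp01 _ => u; rewrite /x0.
have [u0|u0] := leP 0 u.
  rewrite line_to_unitD1 // /f0; have := line_to_unit_ge0 u0 => h.
  by split_ifs; lra.
have [u1|u1] := leP (u + 1) 0.
  rewrite line_to_unitN 1?[RHS]line_to_unitN; try lra.
  have -> : - u = - (u + 1) + 1 by lra.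
  rewrite line_to_unitD1; last by lra.
  have := @line_to_unit_ge0 (- (u + 1)) => h.
  by rewrite /f0; split_ifs; lra.
rewrite line_to_unitN; last by lra.
by rewrite !line_to_unit01; [rewrite /f0; split_ifs|..]; lra.
Qed.

Lemma to_F_x1 : to_F (@x1 R) = @f1 R.
Proof.
apply: to_F_eq f1_supp01 _ => u; rewrite /f1 /x1.
have [u0|u0] := leP u 0.
  rewrite f0_supp01; first by lra.
  have := @line_to_unit_ge0 (- u); rewrite [L u]line_to_unitN; lra.
have [u1|u1] := ltP u 1; last first.
  rewrite (_ : (if _ then _ else _) = u + 1); last by split_ifs; lra.
  rewrite line_to_unitD1; last by lra.
  have := @line_to_unit_ge0 (u - 1); have := line_to_unitD1 (u := u - 1).
  by rewrite subrK /f0; split_ifs; lra.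
rewrite (_ : u <= 1); last by lra.
rewrite [L u]line_to_unit01; last by lra.
have [u2|u2] := ltP (2 * u) 1.
  by rewrite line_to_unit01 /f0; [split_ifs|]; lra.
rewrite -(subrK 1 (2 * u)) line_to_unitD1; last by lra.
by rewrite line_to_unit01 /f0; [split_ifs|]; lra.
Qed.

(** The identification maps [0, 1] affinely onto [1/2, 3/4], the left half of the right half. *)
Lemma to_F_supp01_copy f : {homo f : u v / u < v} -> supp01 f ->
  to_F f = half_copy true (half_copy false f).
Proof.
move=> fi sf; apply: to_F_eq => [|u]; first by do 2!apply: half_copy_supp01.
rewrite /half_copy /=; have [u0|u0] := ltP u 0.
  have Lu : L u <= 1 / 2.
    rewrite line_to_unitN; last exact: ltW.
    by have := @line_to_unit_ge0 (- u); lra.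
  by rewrite [f u]sf ?[f (_ - 0)]sf; lra.
have [u1|u1] := leP 1 u.
  have Lu : 3 / 4 <= L u.
    rewrite -(subrK 1 u) line_to_unitD1; last by lra.
    by have := @line_to_unit_ge0 (u - 1); lra.
  by rewrite [f u]sf ?[f (_ - 0)]sf; lra.
rewrite [L u]line_to_unit01; last by lra.
have -> : 2 * (2 * (1 / 2 + u / 4) - 1) - 0 = u by lra.
by rewrite line_to_unit01; [lra|apply: supp01_itv => //; lra].
Qed.

End LineToUnit.

(** * Words *)

Section WordDecomposition.
Variable R : realType.
Implicit Types (f g d e : R -> R) (t x y : R).

(** Everything at or below a leaf is good, so the bad intervals are among the internal nodes: those
    of the first tree for [f], those of the second for [g]. *)
Lemma diagram_complexity (D : tree * tree) f g :
  f 0 = 0 -> f 1 = 1 -> cancel f g -> cancel g f ->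
  size (node_addr D.1) = size (node_addr D.2) ->
  (forall s u, (s, u) \in zip (leaf_addr D.1) (leaf_addr D.2) -> good f s u) ->
  complexity f (size (node_addr D.1)) (size (node_addr D.1)) /\
  complexity g (size (node_addr D.1)) (size (node_addr D.1)).
Proof.
move=> f0E f1E fK gK sz H.
have cov T h : (forall p, p \in leaf_addr T -> exists u, good h p u) ->
    covers h (node_addr T).
  move=> Hl s; have [|[p [q [-> /Hl[u gu]]]]] := node_or_below_leaf T s; first by left.
  by right; exists (u ++ q); exact: good_cat.
have szl : size (leaf_addr D.1) = size (leaf_addr D.2) by rewrite !size_leaf_addr sz.
have g0E : g 0 = 0 by rewrite -{1}f0E fK.
have g1E : g 1 = 1 by rewrite -{1}f1E fK.
split; split=> //.
- exact: can_inj fK.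
- exists (node_addr D.1); split=> //; last exact: count_size.
  apply: cov => p /(nthP [::])[i il <-].
  exists (nth [::] (leaf_addr D.2) i); apply: H.
  by rewrite -nth_zip // mem_nth // size_zip -szl minnn.
- exact: can_inj gK.
- exists (node_addr D.2); split=> //; rewrite ?sz //; last exact: count_size.
  apply: cov => p /(nthP [::])[i il <-].
  exists (nth [::] (leaf_addr D.1) i); apply: (good_inv fK); apply: H.
  by rewrite -nth_zip // mem_nth // size_zip szl minnn.
Qed.

Lemma f0_complexity g : cancel (@f0 R) g -> cancel g (@f0 R) ->
  complexity (@f0 R) 2 2 /\ complexity g 2 2.
Proof.
move=> fK gK; have s0 := @f0_supp01 R.
apply: (@diagram_complexity (Node (Node Leaf Leaf) Leaf, Node Leaf (Node Leaf Leaf))) => //.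
- exact: supp01_0.
- exact: supp01_1.
move=> s u /=; rewrite !inE => /or3P[] /eqP[-> ->] t t01 /=.
all: by rewrite /f0; split_ifs; lra.
Qed.

Lemma f1_complexity g : cancel (@f1 R) g -> cancel g (@f1 R) ->
  complexity (@f1 R) 3 3 /\ complexity g 3 3.
Proof.
move=> fK gK; have s0 := @f1_supp01 R.
apply: (@diagram_complexity (Node Leaf (Node (Node Leaf Leaf) Leaf),
                             Node Leaf (Node Leaf (Node Leaf Leaf)))) => //.
- exact: supp01_0.
- exact: supp01_1.
move=> s u /=; rewrite !inE => /or4P[] /eqP[-> ->] t t01 /=.
all: by rewrite /f1 /f0; split_ifs; lra.
Qed.

(** The copy of [f] lives in [1/2, 3/4]. Only [0, 1] and [1/2, 1] are added to the cover, and only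
    these two can touch the boundary, whatever [m] is; this makes the bound on [c] linear. *)
Lemma to_F_supp01_complexity f n m : {homo f : x y / x < y} -> supp01 f ->
  complexity f n m -> complexity (to_F f) (n + 2) 2.
Proof.
move=> fi sf [_ _ finj [B [cB sB _]]].
have sF := @to_F_supp01 R f.
split; [exact: supp01_0|exact: supp01_1| |].
  rewrite to_F_supp01_copy // /half_copy => x y /= E.
  have : f (2 * (2 * x - 1) - 0) = f (2 * (2 * y - 1) - 0) by lra.
  by move=> /finj; lra.
exists ([::] :: map (cons true) ([::] :: map (cons false) B)); split.
- rewrite to_F_supp01_copy //; apply: covers_half_copy; last exact: covers_half_copy.
  exact: half_copy_supp01.
- by rewrite /= !size_map addn2 !ltnS.
rewrite /= -map_comp count_map -[leqRHS]addn0 addnA leq_add //.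
  by case: side; case: side.
rewrite leqn0; apply/eqP; rewrite -(count_pred0 B); apply: eq_count => s /=.
by rewrite /side /=; have := @scale_itv R s 0; have := @scale_itv R s 1; lra.
Qed.

Definition translation_ends d := exists (M : R) (k l : int),
  [/\ 0 < M, forall u, u > M -> d u = u + k%:~R &
             forall u, u < - M -> d u = u + l%:~R].

Lemma translation_ends_comp d e :
  translation_ends d -> translation_ends e -> translation_ends (d \; e).
Proof.
move=> [M [k [l [M0 dk dl]]]] [N [k' [l' [N0 ek el]]]].
(* The absolute values keep a point beyond [N] after its translation by [k] or [l]. *)
exists (M + N + `|k%:~R| + `|l%:~R|), (k + k'), (l + l').
have hk : - `|k%:~R : R| <= k%:~R <= `|k%:~R : R| by rewrite -ler_norml.
have hl : - `|l%:~R : R| <= l%:~R <= `|l%:~R : R| by rewrite -ler_norml.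
rewrite !intrD; split=> [|u hu|u hu] /=; first by lra.
- by rewrite dk ?ek; lra.
- by rewrite dl ?el; lra.
Qed.

Lemma translation_ends_inv d e : cancel d e ->
  translation_ends d -> translation_ends e.
Proof.
move=> dK [M [k [l [M0 dk dl]]]].
exists (M + `|k%:~R| + `|l%:~R|), (- k), (- l).
have hk : - `|k%:~R : R| <= k%:~R <= `|k%:~R : R| by rewrite -ler_norml.
have hl : - `|l%:~R : R| <= l%:~R <= `|l%:~R : R| by rewrite -ler_norml.
rewrite !rmorphN; split=> [|u hu|u hu] /=; first by lra.
- by rewrite -[in RHS](dK (u - k%:~R)) dk ?subrK ?dK //; lra.
- by rewrite -[in RHS](dK (u - l%:~R)) dl ?subrK ?dK //; lra.
Qed.

Lemma supp01_translation_ends f : supp01 f -> translation_ends f.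
Proof.
by move=> sf; exists 1, 0, 0; split=> // u hu; rewrite addr0 sf //; lra.
Qed.

Lemma x0_translation_ends : translation_ends (@x0 R).
Proof. by exists 1, 1, 1. Qed.

Lemma x1_translation_ends : translation_ends (@x1 R).
Proof.
by exists 1, 1, 0; split=> // u hu; rewrite /x1; split_ifs; lra.
Qed.

(** Inverses are bounded along with the maps: they occur in the conjugates of [x1], in the inverse
    letters and in the second trees of diagrams. *)
Definition F_pair n f g :=
  [/\ plpair f g, supp01 f, complexity f n n & complexity g n n].

Definition Fx_pair n m d e :=
  [/\ plpair d e, translation_ends d,
      complexity (to_F d) n m & complexity (to_F e) n m].

Lemma F_pairC n f g : F_pair n f g -> F_pair n g f.
Proof. by case=> [[fK gK pf pg] sf cf cg]; split=> //; exact: supp01_inv sf. Qed.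

Lemma F_pair_comp n m f g f' g' : F_pair n f g -> F_pair m f' g' ->
  F_pair (n + m) (f \; f') (g' \; g).
Proof.
move=> [pf sf cf cg] [pf' sf' cf' cg']; split.
- exact: plpair_comp.
- exact: supp01_comp.
- exact: complexity_comp.
- by rewrite addnC; exact: complexity_comp.
Qed.

Lemma Fx_pairC n m d e : Fx_pair n m d e -> Fx_pair n m e d.
Proof.
by case=> [[dK eK pd pe] td cd ce]; split=> //; exact: translation_ends_inv td.
Qed.

Lemma Fx_pair_comp n m n' m' d e d' e' : Fx_pair n m d e -> Fx_pair n' m' d' e' ->
  Fx_pair (n + n') (m + m') (d \; d') (e' \; e).
Proof.
move=> [pd td cd ce] [pd' td' cd' ce']; split.
- exact: plpair_comp.
- exact: translation_ends_comp.
- by rewrite to_F_comp; exact: complexity_comp.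
- by rewrite to_F_comp addnC [(m + _)%N]addnC; exact: complexity_comp.
Qed.

Lemma F_pair_le n m f g : (n <= m)%N -> F_pair n f g -> F_pair m f g.
Proof. by move=> nm [p s c c']; split=> //; exact: (complexity_le nm nm). Qed.

Lemma Fx_pair_le n m n' m' d e : (n <= n')%N -> (m <= m')%N ->
  Fx_pair n m d e -> Fx_pair n' m' d e.
Proof. by move=> nn mm [p s c c']; split=> //; exact: (complexity_le nn mm). Qed.

(** Here [f] itself, not its periodic extension, is regarded as a map of the line. *)
Lemma F_pair_Fx n f g : F_pair n f g -> Fx_pair (n + 2) 2 f g.
Proof.
move=> fg; have [pfg sf cf cg] := fg; have [_ _ [fi _ _ _] [gi _ _ _]] := pfg.
have [_ sg _ _] := F_pairC fg; split=> //; first exact: supp01_translation_ends.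
  exact: to_F_supp01_complexity cf.
exact: to_F_supp01_complexity cg.
Qed.

Lemma F_pair_f0 : exists g, F_pair 3 (@f0 R) g.
Proof.
have [g fg] := plpair_f0 R; exists g; have [fK gK _ _] := fg.
apply: (@F_pair_le 2) => //; have [c c'] := f0_complexity fK gK.
by split=> //; exact: f0_supp01.
Qed.

Lemma F_pair_f1 : exists g, F_pair 3 (@f1 R) g.
Proof.
have [g fg] : exists g, plpair (@f1 R) g.
  by have [g /plpair_half_copy fg] := plpair_f0 R; eexists; exact: fg.
exists g; have [fK gK _ _] := fg; have [c c'] := f1_complexity fK gK.
by split=> //; exact: f1_supp01.
Qed.

Lemma Fx_pair_x0 : exists e, Fx_pair 2 2 (@x0 R) e.
Proof.
exists (fun x => x - 1); have p := plpair_x0 R; have [dK eK _ _] := p.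
have := @f0_complexity (to_F (fun x : R => x - 1)); rewrite -to_F_x0.
case=> [||c c']; [exact: to_FK|exact: to_FK|].
by split=> //; exact: x0_translation_ends.
Qed.

Lemma Fx_pair_x1 : exists e, Fx_pair 3 3 (@x1 R) e.
Proof.
have [e p] := plpair_x1 R; exists e; have [dK eK _ _] := p.
have := @f1_complexity (to_F e); rewrite -to_F_x1.
case=> [||c c']; [exact: to_FK|exact: to_FK|].
by split=> //; exact: x1_translation_ends.
Qed.

(** The factor is a product of [g], [x1], [f] and the conjugate of [f] by [x0]. Three factors cost
    (n + 2, 2) each, [x1] costs (3, 3), and [x0] and its inverse cost (2, 2) each, which adds up to
    (3n + 13, 13). *)
Lemma Fx_pair_x1_sigma n f g : F_pair n f g ->
  exists d e, Fx_pair (3 * n + 13) 13 d e /\ @x1 R \; sigma f = sigma f \; d.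
Proof.
move=> fg; have [[fK gK [fi _ _ _] _] sf _ _] := fg.
have pf := F_pair_Fx fg; have [e1 p1] := Fx_pair_x1; have [e0 p0] := Fx_pair_x0.
have h := Fx_pair_comp (Fx_pair_comp (Fx_pairC pf) p1) pf.
have {}h := Fx_pair_comp h (Fx_pair_comp (Fx_pair_comp (Fx_pairC p0) pf) p0).
eexists; eexists; split; last exact: x1_sigma fi sf fK.
have e0E : e0 = (fun x => x - 1).
  have [[_ e0K _ _] _ _ _] := p0.
  by apply/funext => x; rewrite -[in RHS](e0K x) /x0 addrK.
move: h; rewrite e0E => h; apply: Fx_pair_le h => //; lia.
Qed.

Lemma conj_inv (m m' S d e : R -> R) : cancel m' m -> cancel d e ->
  m \; S = S \; d -> m' \; S = S \; e.
Proof.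
move=> mK dK E; apply/funext => x /=.
by rewrite -[in LHS](dK (S (m' x))) -[d _]/((S \; d) _) -E /= mK.
Qed.

(* 22 is large enough for 22 n^2 + (9 n + 13) <= 22 (n + 1)^2, where 9 n + 13 bounds
   the debris added by a letter x1, see Fx_pair_x1_sigma. *)
Definition decomposes n (m : R -> R) := exists f g d e,
  [/\ F_pair (3 * n) f g, Fx_pair (22 * n ^ 2) (13 * n) d e & m = sigma f \; d].

Lemma decomposes_sigma n m f g : F_pair 3 f g -> decomposes n m ->
  decomposes n.+1 (sigma f \; m) .
Proof.
move=> fg [f' [g' [d [e [fg' de ->]]]]]; exists (f \; f'), (g' \; g), d, e; split.
- by rewrite mulnS; exact: F_pair_comp.
- by apply: Fx_pair_le de; nia.
have [[_ _ [fi _ _ _] _] sf _ _] := fg.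
by rewrite -sigma_comp.
Qed.

Lemma decomposes_Fx n m h : (forall f g, F_pair (3 * n) f g -> exists d e,
    Fx_pair (9 * n + 13) 13 d e /\ h \; sigma f = sigma f \; d) ->
  decomposes n m -> decomposes n.+1 (h \; m).
Proof.
move=> H [f [g [d [e [fg de ->]]]]]; have [d' [e' [de' E]]] := H f g fg.
exists f, g, (d' \; d), (e \; e'); split.
- by apply: F_pair_le fg; lia.
- by apply: Fx_pair_le (Fx_pair_comp de' de); nia.
by apply/funext => x; rewrite /= -[d' _]/((sigma f \; d') x) -E.
Qed.

Lemma word_decomposes w : decomposes (size w) (@word_map R w).
Proof.
elim: w => [|[s b] w IH].
  have p : plpair (id : R -> R) id.
    have := plpair_comp (plpair_x0 R) (plpairC (plpair_x0 R)).
    by congr plpair; apply/funext => x /=; rewrite /x0 ?addrK ?subrK.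
  exists id, id, id, id; rewrite sigma_id; split=> //; split=> //.
  all: rewrite ?to_F_id; try exact: complexity_id.
  exact: supp01_translation_ends.
rewrite /=; case: s => /=.
- have [e p] := Fx_pair_x0; have [[dK eK _ _] _ _ _] := p.
  apply: decomposes_Fx IH => f g _; rewrite /letter_map /=; case: b.
    exists (@x0 R), e; split; last exact: x0_sigma.
    by apply: Fx_pair_le p; lia.
  rewrite (inverseE dK eK); exists e, (@x0 R); split.
    by apply: Fx_pair_le (Fx_pairC p); lia.
  exact: conj_inv eK dK (x0_sigma f).
- have [e p] := Fx_pair_x1; have [[dK eK _ _] _ _ _] := p.
  apply: decomposes_Fx IH => f g fg; rewrite /letter_map /=.
  have [d' [e' [p' E]]] := Fx_pair_x1_sigma fg; rewrite mulnA in p'.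
  case: b; first by exists d', e'.
  rewrite (inverseE dK eK); exists e', d'; split; first exact: Fx_pairC.
  have [[dK' eK' _ _] _ _ _] := p'; exact: conj_inv eK dK' E.
- have [g fg] := F_pair_f0; have [[fK gK [fi _ _ _] [gi _ _ _]] sf _ _] := fg.
  rewrite /letter_map /=; case: b; first exact: decomposes_sigma fg IH.
  rewrite (@inverseE _ _ (sigma g)); [|exact: sigmaK|].
    exact: decomposes_sigma (F_pairC fg) IH.
  by apply: sigmaK => //; exact: supp01_inv sf.
- have [g fg] := F_pair_f1; have [[fK gK [fi _ _ _] [gi _ _ _]] sf _ _] := fg.
  rewrite /letter_map /=; case: b; first exact: decomposes_sigma fg IH.
  rewrite (@inverseE _ _ (sigma g)); [|exact: sigmaK|].
    exact: decomposes_sigma (F_pairC fg) IH.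
  by apply: sigmaK => //; exact: supp01_inv sf.
Qed.

End WordDecomposition.

(** * Uniqueness of the decomposition and the final estimate *)

Section MainTheorem.
Variable R : realType.
Implicit Types (f g d e : R -> R) (t x y : R).

(** If [f 0] were positive, a preimage of [f 0 / 2] could be neither negative, where [f] is the
    identity, nor nonnegative, by monotonicity. The endpoint 1 is symmetric. *)
Lemma thompsonF_supp01 f : thompsonF f -> supp01 f.
Proof.
move=> [[[fi [g [fK gK _ _]]] _ _ _] _ fid].
have fI := can_inj fK.
have fixed t : ~~ (0 <= f t <= 1) -> f t = t by move=> /fid/fI.
have f0E : f 0 = 0.
  have [h|/fixed//] := boolP (0 <= f 0 <= 1).
  have [f0|] := ltP 0 (f 0); last by lra.
  have := gK (f 0 / 2); set p := g _ => pE.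
  have [p0|] := ltP p 0; first by have := fid p; rewrite pE; lra.
  rewrite le_eqVlt => /orP[/eqP p0|/fi]; last by rewrite pE; lra.
  by move: pE; rewrite -p0; lra.
have f1E : f 1 = 1.
  have [h|/fixed//] := boolP (0 <= f 1 <= 1).
  have [f1|] := ltP (f 1) 1; last by lra.
  have := gK ((f 1 + 1) / 2); set p := g _ => pE.
  have [p1|] := ltP 1 p; first by have := fid p; rewrite pE; lra.
  rewrite le_eqVlt => /orP[/eqP p1|/fi]; last by rewrite pE; lra.
  by move: pE; rewrite p1; lra.
move=> t ht; have [t01|] := boolP (0 <= t <= 1); last exact: fid.
by have [->|->] : t = 0 \/ t = 1 by lra.
Qed.

(** This is the triviality of the intersection of [F_w] and [F_x]: far to the right [sigma f] is a
    translation, which must be trivial because integers are fixed, and periodicity brings this back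
    to [0, 1]. *)
Lemma sigma_translation_ends f : supp01 f -> translation_ends (sigma f) -> f = id.
Proof.
move=> sf [M [k [_ [M0 H _]]]]; apply/funext => t; rewrite -[id t]/t.
have [t01|nt] := boolP (0 <= t < 1); last by rewrite sf //; lra.
have [n nM] : exists n : int, M < n%:~R.
  by exists (Num.floor M + 1); exact: floorD1_gt.
have Mt : M < n%:~R + t by lra.
have M0' : M < n%:~R + 0 by lra.
have := H _ M0'; have := H _ Mt.
by rewrite !sigmaE ?(supp01_0 sf) ?lexx ?ltr01 //=; lra.
Qed.

Lemma pi_C_sigma f h d e : plpair f h -> supp01 f -> plpair d e ->
  translation_ends d -> pi_C (sigma f \; d) = f /\ debris (sigma f \; d) = d.
Proof.
move=> pf sf pd td; have [fK hK [fi _ _ _] [hi _ _ _]] := pf.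
have sh := supp01_inv fK sf; have [dK eK _ _] := pd.
have dE : inverse (sigma f) \; (sigma f \; d) = d.
  rewrite (@inverseE _ _ (sigma h)); [|exact: sigmaK|exact: sigmaK].
  by apply/funext => x /=; rewrite sigmaK.
suff piE : pi_C (sigma f \; d) = f by rewrite /debris piE dE.
apply: xget_unique => [|y [yF [_ ty]]].
  have [PLf bf] := plpair_PL2 pf; have [PLd _] := plpair_PL2 pd; split.
    by split=> // t ht; apply: sf; lra.
  by rewrite dE; split.
have sy := thompsonF_supp01 yF; have [[[yi [z [yK zK _ _]]] _ _ _] _ _] := yF.
have zi : {homo z : a b / a < b}.
  by move=> a b ab; rewrite -(leW_mono (le_mono yi)) !zK.
have sz := supp01_inv yK sy.
(* Another candidate [y] has inverse [z], and [sigma (z \; f)] is the product of its debris with the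
   inverse of [d], hence a translation near both ends. *)
suff zfE : z \; f = id.
  apply/funext => t; rewrite -[in LHS](hK (y t)) -[in RHS](yK t).
  by rewrite -[f (z _)]/((z \; f) (y t)) zfE hK.
apply: sigma_translation_ends; first exact: supp01_comp.
rewrite -sigma_comp //.
have := translation_ends_comp ty (translation_ends_inv dK td).
rewrite (@inverseE _ _ (sigma z)); [|exact: sigmaK|exact: sigmaK].
by congr translation_ends; apply/funext => x /=; rewrite dK.
Qed.

(** Membership in C makes the set of lengths of words for [g] nonempty; its minimum is then what
    [xget] returns, not the junk value 0. *)
Lemma word_length_witness g : groupC g ->
  exists w, size w = word_length g /\ @word_map R w = g.
Proof.
move=> [w _ wg]; pose P n := `[< exists2 w, size w = n & @word_map R w = g >].
have exP : exists n, P n by exists (size w); apply/asboolP; exists w.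
have [[v sv vg] _] : (exists2 v, size v = word_length g & @word_map R v = g) /\
    forall v, @word_map R v = g -> (word_length g <= size v)%N.
  rewrite /word_length.
  apply: (@xgetPex _ 0%N [set n | (exists2 w, size w = n & @word_map R w = g) /\
    forall w, @word_map R w = g -> (n <= size w)%N]).
  case: (ex_minnP exP) => n /asboolP nP min; exists n; split=> // v vg.
  by apply: min; apply/asboolP; exists v.
by exists v.
Qed.

(** A shortest word is decomposed. The constant 26 is twice 13, since [c] counts the side carets of
    both trees, one bounded through [d] and the other through its inverse. *)
Lemma complexity_bounds g : groupC g -> let n := word_length g in
  [/\ (a_of g <= 3 * n)%N, (b_of g <= 22 * n ^ 2)%N & (c_of g <= 26 * n)%N].
Proof.
move=> /word_length_witness[w [<- <-]] /=.
have [f [h [d [e [[pf sf cf _] [pd td cd ce] wE]]]]] := word_decomposes R w.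
have [piE dE] := pi_C_sigma pf sf pd td; have [dK eK _ _] := pd.
rewrite /a_of /b_of /c_of wE piE dE; split; [exact: carets_F_le cf|exact: carets_F_le cd|].
apply: leq_trans (side_carets_F_le (to_FK dK) (to_FK eK) cd ce) _; lia.
Qed.

End MainTheorem.

Theorem mainTheorem3 (R : realType) :
  exists K : R, 0 < K /\
    forall g : R -> R, groupC g ->
      (a_of g)%:R + Num.sqrt (b_of g)%:R + (c_of g)%:R
        <= K * (word_length g)%:R.
Proof.
(* Here 34 = 3 + 5 + 26, where 5 bounds the square root of 22. *)
exists 34; split=> [|g /complexity_bounds[]]; first by [].
set n := word_length g => ha hb hc.
have {}ha : (a_of g)%:R <= 3 * n%:R :> R by rewrite -natrM ler_nat.
have {}hc : (c_of g)%:R <= 26 * n%:R :> R by rewrite -natrM ler_nat.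
suff hs : Num.sqrt (b_of g)%:R <= 5 * n%:R :> R by lra.
rewrite -[5 * _]ger0_norm ?mulr_ge0 // -sqrtr_sqr ler_wsqrtr //.
rewrite -natrM -natrX ler_nat; nia.
Qed.
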